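(* Let $K/k$ be a separable field extension of degree $6$ and let $\widetilde{K}/k$ be its Galois closure. Assume that $\operatorname{Gal}(\widetilde{K}/k)\simeq A_5$ and let $F$ be a field with $K\subseteq F\subsetneq\widetilde{K}$. Then $F/k$ is not Hopf Galois.
   Context: A finite extension of fields $L/k$ is called Hopf Galois if there exists a finite cocommutative $k$-Hopf algebra $H$ such that $L$ is an $H$-module algebra and the $k$-linear map $j: L\otimes_k H\to \operatorname{End}_k(L)$, $j(s\otimes h)(t)=s(ht)$ for $h\in H$, $s,t\in L$, is bijective. *)

(* Defs.v *)
From HB Require Import structures.
From mathcomp Require Import all_boot all_order all_algebra all_fingroup.
From mathcomp Require Import all_solvable all_field.

Set Implicit Arguments.
Unset Strict Implicit.
Unset Printing Implicit Defensive.

Import GRing.Theory.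
Local Open Scope ring_scope.

(* The tensor product of two finite dimensional spaces is realised as the     *)
(* space of coordinate matrices with respect to their library bases; it is    *)
(* characterised, independently of these bases, by the universal property     *)
(* [tensor_lift_tens] (existence) and [tensor_ext] (uniqueness).              *)
Definition tensor (k : fieldType) (U V : vectType k) : vectType k :=
  'M[k]_(\dim {:U}, \dim {:V}).

Section Tensor.
Variable k : fieldType.
Implicit Types U V W : vectType k.

Definition tens U V (u : U) (v : V) : tensor U V :=
  \matrix_(i, j) (coord (vbasis {:U}) i u * coord (vbasis {:V}) j v).

(* The linear map U (x) V -> W induced by f; only meant for bilinear f.       *)
Definition tensor_lift U V (W : lmodType k) (f : U -> V -> W)
    (t : tensor U V) : W :=
  \sum_i \sum_j
    (t : 'M_(_, _)) i j *: f (vbasis {:U})`_i (vbasis {:V})`_j.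

Lemma tensor_lift_is_linear U V (W : lmodType k) (f : U -> V -> W) :
  linear (tensor_lift f).
Proof.
move=> a t s; rewrite /tensor_lift scaler_sumr -big_split /=.
apply: eq_bigr => i _; rewrite scaler_sumr -big_split /=.
by apply: eq_bigr => j _; rewrite !mxE scalerDl scalerA.
Qed.

HB.instance Definition _ U V (W : lmodType k) (f : U -> V -> W) :=
  GRing.isLinear.Build k (tensor U V) W _ (tensor_lift f)
    (tensor_lift_is_linear f).

Lemma tensor_lift_tens U V (W : lmodType k) (f : U -> V -> W) u v :
    (forall x, linear (f x)) -> (forall y, linear (f^~ y)) ->
  tensor_lift f (tens u v) = f u v.
Proof.
move=> fr fl.
have fsr x n (a : 'I_n -> k) (e : 'I_n -> V) :
    f x (\sum_i a i *: e i) = \sum_i a i *: f x (e i).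
  pose g := GRing.isLinear.Build k V W _ (f x) (fr x).
  pose h : {linear V -> W} := HB.pack (f x) g.
  by rewrite -[f x]/(h : V -> W) linear_sum; apply: eq_bigr => i _; rewrite linearZ.
have fsl y n (a : 'I_n -> k) (e : 'I_n -> U) :
    f (\sum_i a i *: e i) y = \sum_i a i *: f (e i) y.
  pose g := GRing.isLinear.Build k U W _ (f^~ y) (fl y).
  pose h : {linear U -> W} := HB.pack (f^~ y) g.
  have hE z : f z y = h z by [].
  by rewrite hE linear_sum; apply: eq_bigr => i _; rewrite linearZ.
rewrite {2}(coord_vbasis (memvf u)) {2}(coord_vbasis (memvf v)) fsl /tensor_lift.
apply: eq_bigr => i _; rewrite fsr scaler_sumr.
by apply: eq_bigr => j _; rewrite mxE scalerA.
Qed.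

Lemma tensor_ext U V (W : lmodType k) (f g : {linear tensor U V -> W}) :
  (forall u v, f (tens u v) = g (tens u v)) -> f =1 g.
Proof.
move=> fg t.
have -> : t = \sum_i \sum_j (t : 'M_(_, _)) i j *:
    tens (vbasis {:U})`_i (vbasis {:V})`_j.
  rewrite {1}[t]matrix_sum_delta; apply: eq_bigr => i _; apply: eq_bigr => j _.
  congr (_ *: _); apply/matrixP => i' j'; rewrite !mxE.
  rewrite !coord_free ?(basis_free (vbasisP _)) //.
  by rewrite (eq_sym i) (eq_sym j) -natrM mulnb.
rewrite !linear_sum; apply: eq_bigr => i _; rewrite !linear_sum.
by apply: eq_bigr => j _; rewrite !linearZ /= fg.
Qed.

Definition tensor_swap U V : tensor U V -> tensor V U :=
  tensor_lift (fun u v => tens v u).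

Definition tensor_map U U' V V' (f : U -> U') (g : V -> V') :
    tensor U V -> tensor U' V' :=
  tensor_lift (fun u v => tens (f u) (g v)).

Definition tensor_assoc U V W :
    tensor (tensor U V) W -> tensor U (tensor V W) :=
  tensor_lift (fun t w => tensor_lift (fun u v => tens u (tens v w)) t).

Definition tensor_mul (A B : falgType k) (s t : tensor A B) : tensor A B :=
  tensor_lift (fun a b =>
    tensor_lift (fun a' b' => tens (a * a') (b * b')) t) s.

End Tensor.

Record hopfAlgebra (k : fieldType) (H : falgType k) := HopfAlgebra {
  comul : {linear H -> tensor H H};
  counit : {linear H -> k^o};
  antipode : {linear H -> H};
  comulA : forall h,
    tensor_assoc (tensor_map comul id (comul h)) =
    tensor_map id comul (comul h);
  counitl : forall h, tensor_lift (fun a b => counit a *: b) (comul h) = h;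
  counitr : forall h, tensor_lift (fun a b => counit b *: a) (comul h) = h;
  comul1 : comul 1 = tens 1 1;
  comulM : forall g h, comul (g * h) = tensor_mul (comul g) (comul h);
  counit1 : counit 1 = 1;
  counitM : forall g h, counit (g * h) = counit g * counit h;
  antipodel : forall h,
    tensor_lift (fun a b => antipode a * b) (comul h) = (counit h)%:A;
  antipoder : forall h,
    tensor_lift (fun a b => a * antipode b) (comul h) = (counit h)%:A
}.

Definition cocommutative (k : fieldType) (H : falgType k)
    (hopfH : hopfAlgebra H) : Prop :=
  forall h, tensor_swap (comul hopfH h) = comul hopfH h.

Record moduleAlgebra (k : fieldType) (H : falgType k)
    (hopfH : hopfAlgebra H) (A : falgType k) := ModuleAlgebra {
  act : {linear H -> 'End(A)};
  act1 : forall a, act 1 a = a;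
  actM : forall g h a, act (g * h) a = act g (act h a);
  act_one : forall h, act h 1 = (counit hopfH h)%:A;
  act_mul : forall h a b,
    act h (a * b) =
    tensor_lift (fun h1 h2 => act h1 a * act h2 b) (comul hopfH h)
}.

Definition hopf_galois_map (k : fieldType) (H : falgType k)
    (hopfH : hopfAlgebra H) (L : falgType k) (rho : moduleAlgebra hopfH L) :
    tensor L H -> 'End(L) :=
  tensor_lift (fun s h => linfun (fun t : L => s * act rho h t)).

Definition hopf_galois (k : fieldType) (L : fieldExtType k) : Prop :=
  exists (H : falgType k) (hopfH : hopfAlgebra H)
         (rho : moduleAlgebra hopfH L),
    cocommutative hopfH /\ bijective (hopf_galois_map rho).

Definition galois_closure (k : fieldType) (L : splittingFieldType k)
    (U K E : {subfield L}) : Prop :=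
  [/\ (K <= E)%VS, galois U E &
      forall M : {subfield L}, (K <= M)%VS -> galois U M -> (E <= M)%VS].

(* Main.v *)
(* Write X for the set of k-embeddings F -> E, where E is the Galois closure
   with group G, and extend scalars to E.  Evaluating the action of H after an
   embedding x identifies E (x) H with Hom_k(F, E) as coalgebras, so the elements
   of E (x) H sent into X are the grouplike ones, whatever x is.  These grouplike
   elements form a group N acting on X by sharply transitive permutations, and
   the semilinear action of G shows that G normalizes N (this is one half of the
   Greither-Pareigis correspondence).

   Here G = A_5 and |N| = |X| = [F : k] is 6, 12 or 30.  Sylow counting produces
   a nontrivial element of G centralizing N; as G is simple, all of G does.  But
   the centralizer of a transitive group acts freely, so |G| <= |X| <= 30. *)
Require Import Defs.
From mathcomp Require Import all_boot all_order all_algebra all_fingroup.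
From mathcomp Require Import all_solvable all_field.
From HB Require Import structures.

Set Implicit Arguments.
Unset Strict Implicit.
Unset Printing Implicit Defensive.

Import GRing.Theory.

(** * Regular groups of order 6, 12 or 30 normalized by a simple group of order 60 *)

Section RegularPermutationGroups.
Local Open Scope group_scope.

Lemma card_cent_mod (gT : finGroupType) (p : nat) (U N : {group gT}) :
  p.-group U -> U \subset 'N(N) -> #|N| = #|'C_N(U)| %[mod p].
Proof.
move=> pU nNU; rewrite (pgroup_fix_mod (to := 'J) pU) ?astabsJ //.
by rewrite afixJ.
Qed.

(** Conjugation by [U] permutes the Sylow [q]-subgroups of [N]; their number is not a multiple of
    [p], so one of them is fixed. *)
Lemma pgroup_norm_Syl (gT : finGroupType) (p q : nat) (U N : {group gT}) :
    p.-group U -> U \subset 'N(N) -> ~~ (p %| #|'Syl_q(N)|) ->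
  exists2 P : {group gT}, q.-Sylow(N) P & U \subset 'N(P).
Proof.
move=> pU nNU ndvd.
have actU: [acts U, on 'Syl_q(N) | 'JG].
  apply/subsetP=> u Uu; rewrite !inE /=; apply/subsetP=> P; rewrite !inE.
  by rewrite -{2}(normsP nNU u Uu) pHallJ2.
have := pgroup_fix_mod pU actU; case: (set_0Vmem 'Fix_('Syl_q(N) | 'JG)(U)).
  by move=> ->; rewrite cards0 mod0n => /eqP; rewrite -/(_ %| _) (negPf ndvd).
case=> P /setIP[]; rewrite inE => sylP /afixP fixP _; exists P => //.
apply/subsetP=> u Uu; rewrite inE.
by have /(congr1 val) /= -> := fixP u Uu.
Qed.

(** For a [U]-invariant Sylow subgroup [P], the order of ['C_P(U)] divides [#|P|] and agrees with it
    modulo [p]; the last hypothesis then forces [U] to centralize [P]. *)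
Lemma pgroup_cent_Syl (gT : finGroupType) (p q : nat) (U N : {group gT}) :
    p.-group U -> U \subset 'N(N) -> ~~ (p %| #|'Syl_q(N)|) ->
    (forall P : {group gT}, q.-Sylow(N) P -> forall d, d %| #|P| ->
        d = #|P| %[mod p] -> d = #|P|) ->
  (#|N|`_q)%N %| #|'C_N(U)|.
Proof.
move=> pU nNU ndvd hd; have [P sylP nPU] := pgroup_norm_Syl pU nNU ndvd.
rewrite -(card_Hall sylP) -(hd P sylP #|'C_P(U)|) ?cardSg ?subsetIl //.
  by rewrite setSI // (pHall_sub sylP).
by rewrite -(card_cent_mod pU nPU).
Qed.

Lemma order5_cent_6_12 (gT : finGroupType) (U N : {group gT}) :
    5.-group U -> U \subset 'N(N) -> #|N| \in [:: 6; 12] -> U \subset 'C(N).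
Proof.
move=> pU nNU oN; rewrite centsC; apply/setIidPl/eqP.
rewrite eqEcard subsetIl /=.
have o3 : (#|N|`_3 = 3)%N by rewrite !inE in oN; rewrite p_part; case/orP: oN => /eqP->.
have d3: 3 %| #|'C_N(U)|.
  rewrite -o3; apply: (pgroup_cent_Syl (p := 5)) => // [|P sylP d].
    have := @card_Syl_mod 3 _ N isT; have := card_Syl_dvd 3 N.
    have: #|'Syl_3(N)| <= 12.
      apply: leq_trans (dvdn_leq _ (card_Syl_dvd 3 N)) _ => //.
      by rewrite !inE in oN; case/orP: oN => /eqP->.
    (* A Sylow count dividing 6 or 12 and congruent to 1 modulo 3 is 1 or 4, never a multiple of
       5. *)
    by move: oN; rewrite !inE => /orP[] /eqP->;
       move: #|'Syl_3(N)|; do 14?case => //.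
  rewrite (card_Hall sylP) o3 => /(dvdn_leq (isT : 0 < 3)).
  by move: d; do 5?case => //.
(* Among the multiples of 3 dividing [#|N|], only [#|N|] itself has the right residue modulo 5. *)
have := card_cent_mod pU nNU; have : #|'C_N(U)| %| #|N|.
  by rewrite cardSg ?subsetIl.
move: oN d3; rewrite !inE => /orP[] /eqP->; move: #|_ :&: _| => d d3 dN;
  have := dvdn_leq (ltn0Sn _) dN; move: d d3 dN; do 14?case => //.
Qed.

Lemma card_free_involution (X : finType) (t : {perm X}) :
    t ^+ 2 = 1 -> (forall x, t x != x) -> #|X| = (#|porbits t| * 2)%N.
Proof.
move=> t2 ft.
rewrite -cardsT; apply: card_uniform_partition (_ : partition (porbits t) setT).
  move=> A /imsetP[x _ ->].
  have -> : porbit t x = [set x; t x].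
    apply/setP=> y; rewrite !inE; apply/porbitP/orP=> [[i ->]|].
      rewrite -(odd_double_half i) -mul2n expgD expgM t2 expg1n mulg1.
      by case: (odd i); [right | left; rewrite perm1].
    by case=> /eqP->; [exists 0%N; rewrite perm1 | exists 1%N].
  by rewrite cards2 eq_sym ft.
rewrite /porbits.
have -> : [set porbit t x | x : X] = orbit 'P <[t]> @: setT.
  by apply/setP=> A; apply/imsetP/imsetP=> [][x _ ->]; exists x => //; rewrite porbitE.
apply: orbit_partition; apply/subsetP=> u _; rewrite !inE /=.
by apply/subsetP=> x _; rewrite !inE.
Qed.

Lemma regular_free (X : finType) (N : {group {perm X}}) x p :
  [transitive N, on setT | 'P] -> #|N| = #|X| -> p \in N -> p x = x -> p = 1.
Proof.
move=> trN oN Np px; have := card_orbit 'P N x.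
rewrite (atransP trN) ?inE // cardsT -oN.
have := Lagrange (subsetIl N 'C[x | 'P]) => /= {1}<- /eqP.
rewrite -{2}[#|N : _|]mul1n eqn_pmul2r // => /eqP/card1_trivg trC.
have: p \in 'C_N[x | 'P] by rewrite inE Np; apply/astab1P.
by rewrite trC => /set1P.
Qed.

(* An involution without fixed points on 30 letters is a product of 15
   transpositions, hence odd. *)
Lemma odd_half_index2 (X : finType) (N : {group {perm X}}) :
    [transitive N, on setT | 'P] -> #|N| = #|X| -> #|X| = 30%N ->
  #|'Alt_X :&: N| = 15%N.
Proof.
move=> trN oN oX.
have [|t Nt ot] := @Cauchy _ 2 N isT; first by rewrite oN oX.
have ft x : t x != x.
  by apply/eqP=> /(regular_free trN oN Nt) t1; rewrite t1 order1 in ot.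
have t2 : t ^+ 2 = 1 by rewrite -ot expg_order.
have oddt : odd_perm t.
  (* [odd_perm] adds the parities of [#|X|], here 30, and of the number of cycles, here 15. *)
  have := card_free_involution t2 ft; rewrite /odd_perm oX => /eqP.
  by rewrite (_ : 30 = 15 * 2)%N // eqn_pmul2r // => /eqP <-.
have sAN : 'Alt_X :&: N \subset N := subsetIr _ _.
have : #|N : 'Alt_X :&: N| = 2%N.
  apply/eqP; rewrite eqn_leq; apply/andP; split.
    rewrite setIC indexgI; have := card_morphim (@sign_morph X) N.
    by rewrite setTI => <-; rewrite -card_bool max_card.
  rewrite indexg_gt1; apply/subsetPn; exists t => //.
  by rewrite inE Nt andbT Alt_even oddt.
by move=> iA; apply/eqP; rewrite -(eqn_pmul2r (isT : 0 < 2)) -{1}iA Lagrange // oN oX.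
Qed.

(** ['C_Q(N)] is normal in [Q] and contains [U], so it is all of [Q]. *)
Lemma simple_cent (gT : finGroupType) (Q U N : {group gT}) :
    simple Q -> Q \subset 'N(N) -> U \subset Q -> U :!=: 1 -> U \subset 'C(N) ->
  Q \subset 'C(N).
Proof.
case/simpleP=> _ simQ nNQ sUQ ntU cNU.
have nsCQ: 'C_Q(N) <| Q.
  by rewrite /normal subsetIl normsI ?normG ?norms_cent.
case: (simQ _ nsCQ) => [C1 | <-]; last exact: subsetIr.
by case/eqP: ntU; apply/trivgP; rewrite -C1 subsetI sUQ.
Qed.

(** An element of order 5 in [Q] centralizes a Sylow 3-subgroup and a Sylow 5-subgroup of [K], hence
    [K], and by simplicity so does [Q]. For an involution [v] of [Q], the centralizer of [v] in [N]
    then contains [K] and has even order by counting modulo 2, so it is [N]. *)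
Lemma odd_half_cent (gT : finGroupType) (Q N K : {group gT}) :
  simple Q -> #|Q| = 60%N -> Q \subset 'N(N) -> Q \subset 'N(K) ->
  K \subset N -> #|K| = 15%N -> #|N| = 30%N -> Q \subset 'C(N).
Proof.
move=> simQ oQ nNQ nKQ sKN oK oN.
have [|u Qu ou] := @Cauchy _ 5 Q isT; first by rewrite oQ.
have [|v Qv ov] := @Cauchy _ 2 Q isT; first by rewrite oQ.
have sub x : x \in Q -> <[x]> \subset Q by rewrite cycle_subG.
have pU : 5.-group <[u]> by rewrite /pgroup -[#|_|]/#[u] ou.
have pV : 2.-group <[v]> by rewrite /pgroup -[#|_|]/#[v] ov.
have ntU : <[u]> != 1 by rewrite cycle_eq1 -order_gt1 ou.
have ntV : <[v]> != 1 by rewrite cycle_eq1 -order_gt1 ov.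
have nKU := subset_trans (sub u Qu) nKQ.
have nNV := subset_trans (sub v Qv) nNQ.
have hSyl (q : nat) : prime q -> q \in [:: 3; 5] -> q %| #|'C_K(<[u]>)|.
  move=> q_pr q35.
  have oq : (#|K|`_q = q)%N.
    by rewrite p_part oK; move: q35; rewrite !inE => /orP[] /eqP->.
  rewrite -{1}oq; apply: (pgroup_cent_Syl (p := 5)) => // [|P sylP d].
    have := @card_Syl_mod q _ K q_pr; have dS := card_Syl_dvd q K.
    have := dvdn_leq (cardG_gt0 K) dS; move: dS; rewrite oK.
    by move: q35; rewrite !inE => /orP[] /eqP->;
       move: #|'Syl__(K)|; do 17?case => //.
  rewrite (card_Hall sylP) oq => dq; have := dvdn_leq (prime_gt0 q_pr) dq.
  by move: q35 dq; rewrite !inE => /orP[] /eqP->; move: d; do 7?case => //.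
have cKU : <[u]> \subset 'C(K).
  rewrite centsC; apply/setIidPl/eqP; rewrite eqEcard subsetIl /= oK.
  rewrite dvdn_leq // (@Gauss_dvd 3 5) //.
  by rewrite !hSyl.
have cKQ := simple_cent simQ nKQ (sub u Qu) ntU cKU.
apply: (simple_cent simQ nNQ (sub v Qv) ntV).
rewrite centsC; apply/setIidPl/eqP; rewrite eqEcard subsetIl /= oN.
rewrite dvdn_leq // (@Gauss_dvd 2 15) //; apply/andP; split.
  by rewrite /dvdn -(card_cent_mod pV nNV) oN.
by rewrite -oK cardSg // subsetI sKN centsC (subset_trans (sub v Qv)).
Qed.

Lemma no_regular_normalized (X : finType) (N Q : {group {perm X}}) :
    simple Q -> #|Q| = 60%N -> Q \subset 'N(N) ->
    [transitive N, on setT | 'P] -> #|N| = #|X| ->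
  #|X| \in [:: 6; 12; 30] -> False.
Proof.
move=> simQ oQ nNQ trN oN oX.
suff cNQ: Q \subset 'C(N).
  have X0 : 0 < #|X| by rewrite -oN.
  have [x _] := card_gt0P X0.
  (* An element commuting with the transitive group [N] and fixing [x] fixes every point, so the
     [Q]-orbit of [x] has 60 points. *)
  have sc : 'C_Q[x | 'P] = 1.
    apply/trivgP/subsetP=> q /setIP[Qq /astab1P fqx]; apply/set1P/permP=> y.
    have [n Nn ->] := atransP2 trN (in_setT x) (in_setT y).
    have /permP/(_ x) := centsP cNQ q Qq n Nn.
    by rewrite !permM perm1 /= [q x]fqx => <-.
  have := card_orbit 'P Q x; rewrite sc indexg1 oQ => o60.
  have: 60 <= #|X| by rewrite -o60 max_card.
  by move: oX; rewrite !inE => /or3P[] /eqP->.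
have [oX' | oX30] : #|X| \in [:: 6; 12] \/ #|X| = 30%N.
  by move: oX; rewrite !inE => /or3P[] /eqP->; [left | left | right].
  have [|u Qu ou] := @Cauchy _ 5 Q isT; first by rewrite oQ.
  have sUQ : <[u]> \subset Q by rewrite cycle_subG.
  apply: (simple_cent simQ nNQ sUQ); first by rewrite cycle_eq1 -order_gt1 ou.
  apply: order5_cent_6_12; rewrite ?oN ?(subset_trans sUQ) //.
  by rewrite /pgroup -[#|_|]/#[u] ou.
have nAQ : Q \subset 'N('Alt_X :&: N).
  by apply: normsI => //; apply: subset_trans (subsetT Q) (Alt_norm X).
by apply: (odd_half_cent simQ oQ nNQ nAQ (subsetIr _ _)); rewrite ?oN ?odd_half_index2.
Qed.

End RegularPermutationGroups.

(* [r c x y] says that [c] carries [x] to [y]; the induced permutations form the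
   regular group [N]. Antipodes are not required: [quot y x] inverts
   [quot x y] because the action is free. *)
Lemma regular_group_of_rel (X : finType) (C : Type) (r : C -> rel X)
    (quot : X -> X -> C) (e : C) (mul : C -> C -> C) (Q : {group {perm X}}) (x0 : X) :
    (forall x y, r (quot x y) x y) ->
    (forall c x y z, r c x y -> r c x z -> y = z) ->
    (forall c x y, r c x y -> forall x', exists y', r c x' y') ->
    (forall c c' x z, r c x z -> r c' x z -> c = c') ->
    (forall x, r e x x) ->
    (forall c c' x y z, r c x y -> r c' y z -> r (mul c c') x z) ->
    (forall q c, q \in Q ->
      exists c', forall x y, r c x y -> r c' (q x) (q y)) ->
  exists N : {group {perm X}}, [/\ Q \subset 'N(N)%g,
    [transitive N, on setT | 'P]%g & #|N| = #|X|].
Proof.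
move=> rquot rfun rtot rfree r1 rmul rtw.
(* Membership is tested on the single candidate [quot x0 (p x0)]: by freeness nothing else carries
   [x0] to [p x0]. *)
pose N : {set {perm X}} := [set p : {perm X} | [forall x, r (quot x0 (p x0)) x (p x)]].
have NP (p : {perm X}) : reflect (exists c, forall x, r c x (p x)) (p \in N).
  rewrite inE; apply: (iffP forallP) => [rp | [c rc] x].
    by exists (quot x0 (p x0)).
  by rewrite (rfree _ _ _ _ (rquot x0 (p x0)) (rc x0)).
have permN x y : exists2 p : {perm X}, p \in N & p x = y.
  have rc := rquot x y; set c := quot x y in rc.
  pose g z := xchoose (rtot _ _ _ rc z).
  have rg z : r c z (g z) := xchooseP (rtot _ _ _ rc z).
  have ce : mul c (quot y x) = e := rfree _ _ _ _ (rmul _ _ _ _ _ rc (rquot y x)) (r1 x).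
  have rg' z : r (quot y x) (g z) z.
    have [z' rz'] := rtot _ _ _ (rquot y x) (g z).
    have := rmul _ _ _ _ _ (rg z) rz'; rewrite ce => rez.
    by move: rz'; rewrite -(rfun _ _ _ _ (r1 z) rez).
  have gI : injective g.
    by move=> z z' gz; apply: (rfun _ _ _ _ (rg' z)); rewrite gz.
  exists (perm gI); first by apply/NP; exists c => z; rewrite permE.
  by rewrite permE (rfun _ _ _ _ (rg x) rc).
have gN : group_set N.
  apply/group_setP; split; first by apply/NP; exists e => x; rewrite perm1.
  move=> p q /NP[c rp] /NP[d rq]; apply/NP; exists (mul c d) => x.
  by rewrite permM; apply: rmul (rp x) (rq _).
exists (Group gN); split.
- apply/subsetP=> q Qq; rewrite inE; apply/subsetP=> _ /imsetP[p /NP[c rp] ->].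
  have [c' rc'] := rtw q c Qq; apply/NP; exists c' => x.
  have := rc' _ _ (rp (q^-1 x)%g).
  by rewrite permKV /conjg !permM.
- apply/imsetP; exists x0; rewrite ?inE //; apply/esym/setP=> y; rewrite inE.
  by have [p Np <-] := permN x0 y; apply/orbitP; exists p.
- have Ninj : {in N &, injective (fun p : {perm X} => p x0)}.
    move=> p q; rewrite !inE => /forallP rp /forallP rq /= pq0; apply/permP=> x.
    by apply: (rfun _ _ _ _ (rp x)); rewrite pq0.
  rewrite -(card_in_imset Ninj); apply: eq_card => y; apply/imsetP.
  by have [p Np <-] := permN x0 y; exists p.
Qed.

(** * Grouplike elements of a Hopf Galois structure *)

(* Without this, [act] would denote the projection of MathComp's group actions. *)
Local Notation act := Defs.act.

Section LinearMaps.
Local Open Scope ring_scope.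

Lemma linear_linfunE (k : fieldType) (U V : vectType k) (f : U -> V) :
  linear f -> linfun f =1 f.
Proof.
move=> flin; pose g := GRing.isLinear.Build k U V _ f flin.
pose h : {linear U -> V} := HB.pack f g.
exact: (lfunE h).
Qed.

Lemma hopf_galois_dim (k : fieldType) (H : falgType k) (hopfH : hopfAlgebra H)
    (L : falgType k) (rho : moduleAlgebra hopfH L) :
  bijective (hopf_galois_map rho) -> \dim {:H} = \dim {:L}.
Proof.
move=> [g gK Kg].
pose f : 'Hom(tensor L H, 'End(L)) := linfun (hopf_galois_map rho).
have fE t : f t = hopf_galois_map rho t by rewrite lfunE.
have k0 : lker f = 0%VS.
  apply/eqP/lker0P => s t; rewrite !fE; exact: (can_inj gK).
have img : limg f = fullv.
  apply/eqP; rewrite eqEsubv subvf; apply/subvP=> u _.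
  by rewrite -[u]Kg -fE memv_img ?memvf.
have := limg_ker_dim f fullv; rewrite img k0 capv0 dimv0 add0n.
have dT : \dim {:tensor L H} = (\dim {:L} * \dim {:H})%N by rewrite dimvf.
have dE : \dim {:'End(L)} = (\dim {:L} * \dim {:L})%N by rewrite !dimvf.
rewrite dT dE => /eqP; rewrite eqn_pmul2l ?lt0n; first by move/eqP.
by rewrite dimv_eq0 -subv0; apply/negP=> /subvP/(_ 1 (memvf _)); rewrite memv0 oner_eq0.
Qed.

End LinearMaps.

Section GrouplikeElements.
Local Open Scope ring_scope.
Variables (k : fieldType) (E : splittingFieldType k) (F : {subfield E}).
Variables (H : falgType k) (hopfH : hopfAlgebra H).
Variable rho : moduleAlgebra hopfH (subvs_of F).
Hypothesis rho_bij : bijective (hopf_galois_map rho).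

Local Notation L := (subvs_of F).
Local Notation n := (\dim {:H}).
Local Notation h_ j := ((vbasis {:H})`_j).
Local Notation b_ j := ((vbasis {:L})`_j).
Implicit Types (s t : gal_of {:E}) (c : 'rV[E]_n) (a b : L).

(** Embeddings of [F] are represented by automorphisms of [E]; as [E] is normal over [k], every
    embedding is such a restriction. *)
Definition emb s a : E := s (vsval a).

Lemma emb_linear s : linear (emb s).
Proof. by move=> x a b; rewrite /emb !linearP. Qed.
HB.instance Definition _ s := GRing.isLinear.Build k L E _ (emb s) (emb_linear s).

Lemma embM s a b : emb s (a * b) = emb s a * emb s b.
Proof. by rewrite /emb /= rmorphM. Qed.
Lemma emb1 s : emb s 1 = 1.
Proof. by rewrite /emb !rmorph1. Qed.
Lemma emb_alg s x : emb s x%:A = x%:A.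
Proof. by rewrite linearZ /= emb1. Qed.
Lemma emb_gal s t a : emb (s * t)%g a = t (emb s a).
Proof. by rewrite /emb galM ?memvf. Qed.

(* [c] stands for the element [\sum_j c_j (x) h_j] of [E (x) H]. *)
Definition Phi s c a : E := \sum_j c 0 j * emb s (act rho (h_ j) a).

Lemma Phi_linear s c : linear (Phi s c).
Proof.
move=> x a b; rewrite /Phi scaler_sumr -big_split; apply: eq_bigr => j _ /=.
by rewrite !linearP mulrDr scalerAr.
Qed.
HB.instance Definition _ s c := GRing.isLinear.Build k L E _ (Phi s c) (Phi_linear s c).

Lemma linear_basis_ext (f g : {linear L -> E}) :
  (forall m : 'I_(\dim {:L}), f (b_ m) = g (b_ m)) -> f =1 g.
Proof.
move=> fg a; rewrite (coord_vbasis (memvf a)) !linear_sum.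
by apply: eq_bigr => m _; rewrite !linearZ /= fg.
Qed.

Definition Phi_mx s : 'M[E]_(n, \dim {:L}) :=
  \matrix_(j, m) emb s (act rho (h_ j) (b_ m)).

Lemma Phi_mxE s c m : (c *m Phi_mx s) 0 m = Phi s c (b_ m).
Proof. by rewrite mxE; apply: eq_bigr => j _; rewrite mxE. Qed.

(** Surjectivity of the Hopf Galois map gives preimages [T m] of the coordinate forms [e m];
    applying [s] to their [L]-components yields the rows of the left inverse. *)
Lemma Phi_mx_left_inv s : exists B, B *m Phi_mx s = 1%:M.
Proof.
have [g gK Kg] := rho_bij.
pose e m : 'End(L) := linfun (fun a => (coord (vbasis {:L}) m a)%:A : L).
pose T m := g (e m) : 'M_(_, _).
exists (\matrix_(m, j) \sum_i T m i j *: emb s (b_ i)).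
apply/matrixP=> m m'; rewrite !mxE.
have: emb s (e m (b_ m')) = (m == m')%:R.
  rewrite /e linear_linfunE; last by move=> x a b; rewrite linearP scalerDl scalerA.
  rewrite /= coord_free ?(basis_free (vbasisP _)) // emb_alg.
  by rewrite eq_sym; case: eqP; rewrite ?scale1r ?scale0r.
move <-; rewrite -(Kg (e m)) /hopf_galois_map /tensor_lift.
rewrite sum_lfunE linear_sum.
transitivity (\sum_i \sum_j T m i j *: (emb s (b_ i) * emb s (act rho (h_ j) (b_ m')))).
  rewrite exchange_big /=; apply: eq_bigr => j _.
  rewrite !mxE mulr_suml; apply: eq_bigr => i _.
  by rewrite scalerAl.
apply: eq_bigr => i _; rewrite sum_lfunE linear_sum; apply: eq_bigr => j _.
rewrite scale_lfunE linearZ -embM; congr (_ *: emb s _).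
rewrite linear_linfunE // => x a b.
by rewrite linearP mulrDr scalerAr.
Qed.

Lemma Phi_surj s (f : {linear L -> E}) : exists c, forall a, Phi s c a = f a.
Proof.
have [B BA] := Phi_mx_left_inv s.
exists ((\row_m f (b_ m)) *m B); apply: linear_basis_ext => m.
by rewrite /= -Phi_mxE -mulmxA BA mulmx1 mxE.
Qed.

(** The left inverse gives [Phi_mx s] full column rank, and it is square by [hopf_galois_dim]. *)
Lemma Phi_inj s c c' : Phi s c =1 Phi s c' -> c = c'.
Proof.
move=> eqPhi; have [B BA] := Phi_mx_left_inv s.
have: row_free (Phi_mx s).
  rewrite -row_leq_rank; apply: leq_trans (eq_leq (hopf_galois_dim rho_bij)) _.
  by rewrite col_leq_rank; apply/row_fullP; exists B.
move=> /row_free_inj; apply; apply/rowP=> m.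
by rewrite !Phi_mxE eqPhi.
Qed.

(* The coordinates of the comultiplication of [c] in [E (x) H (x) H]. *)
Definition comul_row c (j l : 'I_n) : E :=
  \sum_(i < n) (comul hopfH (h_ i) : 'M_(_, _)) j l *: c 0 i.

(** The axiom [act_mul] after extension of scalars, grouped so that for fixed [b] it is [Phi s] of a
    coefficient row, evaluated at [a]. *)
Lemma Phi_mul s c a b : Phi s c (a * b) =
  \sum_j (\sum_(l < n) comul_row c j l * emb s (act rho (h_ l) b)) * emb s (act rho (h_ j) a).
Proof.
transitivity (\sum_(i < n) \sum_(j < n) \sum_(l < n)
  (comul hopfH (h_ i) : 'M_(_, _)) j l *: (c 0 i *
    (emb s (act rho (h_ l) b) * emb s (act rho (h_ j) a)))).
  apply: eq_bigr => i _; rewrite act_mul /tensor_lift linear_sum mulr_sumr.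
  apply: eq_bigr => j _; rewrite linear_sum mulr_sumr; apply: eq_bigr => l _.
  by rewrite linearZ /= embM -scalerAr (mulrC (emb s _)).
rewrite exchange_big; apply: eq_bigr => j _ /=.
rewrite exchange_big mulr_suml; apply: eq_bigr => l _ /=.
rewrite -mulrA mulr_suml; apply: eq_bigr => i _.
by rewrite scalerAl.
Qed.

(** The right-hand side does not involve [s], so the value at 1 passes from one embedding to
    another. *)
Lemma Phi_one s c : Phi s c 1 = \sum_(j < n) c 0 j * ((counit hopfH (h_ j) : k) *: (1 : E)).
Proof. by apply: eq_bigr => j _; rewrite act_one emb_alg. Qed.

(* [Phi s (x) Phi s] is injective, and it sends both sides to the map
   [(a, b) |-> t (a * b)]. *)
Lemma grouplike s t c : (forall a, Phi s c a = emb t a) ->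
  forall j l, comul_row c j l = c 0 j * c 0 l.
Proof.
move=> ct j l.
(* Injectivity on the tensor square is obtained one factor at a time: [Phi_inj] in [a] with [b]
   fixed, then in [b]. *)
have row_b b : \row_j (\sum_l comul_row c j l * emb s (act rho (h_ l) b)) = emb t b *: c.
  apply: (@Phi_inj s) => a; transitivity (Phi s c (a * b)).
    by rewrite Phi_mul; apply: eq_bigr => i _; rewrite mxE.
  rewrite ct embM -ct mulrC mulr_sumr; apply: eq_bigr => i _.
  by rewrite mxE mulrA.
have row_j : \row_l comul_row c j l = c 0 j *: c.
  apply: (@Phi_inj s) => b; have /rowP/(_ j) := row_b b; rewrite !mxE -ct => jb.
  transitivity (\sum_l comul_row c j l * emb s (act rho (h_ l) b)).
    by apply: eq_bigr => i _; rewrite mxE.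
  rewrite jb mulrC mulr_sumr; apply: eq_bigr => i _.
  by rewrite mxE mulrA.
by have /rowP/(_ l) := row_j; rewrite !mxE.
Qed.

(** Being grouplike is a condition on [c] alone, so [Phi s' c] is multiplicative for every [s'];
    normality extends it to an automorphism of [E]. *)
Lemma grouplike_emb s t s' c : (forall a, Phi s c a = emb t a) ->
  exists t', forall a, Phi s' c a = emb t' a.
Proof.
move=> ct; have gl := grouplike ct.
have PM a b : Phi s' c (a * b) = Phi s' c a * Phi s' c b.
  rewrite Phi_mul mulr_suml; apply: eq_bigr => j _.
  rewrite mulrC -mulrA [RHS]mulrCA; congr (_ * _).
  by rewrite mulr_sumr; apply: eq_bigr => l _; rewrite gl mulrA.
have P1 : Phi s' c 1 = 1 by rewrite Phi_one -(Phi_one s) ct emb1.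
pose f : 'End(E) := linfun (Phi s' c \o vsproj F).
have fE a : f (vsval a) = Phi s' c a by rewrite lfunE /= vsvalK.
have homf : kHom 1 F f.
  rewrite k1HomE; apply/ahom_inP; split.
    move=> x y Fx Fy; rewrite -(vsprojK Fx) -(vsprojK Fy).
    by rewrite -[vsval _ * vsval _]/(vsval (vsproj F x * vsproj F y)) !fE PM.
  have v1 : vsval (1 : L) = 1 by rewrite rmorph1.
  by rewrite -{1}v1 fE.
have [|t' _ ft'] := kHom_to_gal _ (normalFieldf 1) homf.
  by rewrite sub1v subvf.
by exists t' => a; rewrite -fE ft' // subvsP.
Qed.

End GrouplikeElements.

(** * The regular group of permutations of the embeddings *)

Section Embeddings.
Local Open Scope ring_scope.
Variables (k : fieldType) (E : splittingFieldType k) (F : {subfield E}).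
Local Notation L := (subvs_of F).
Local Notation emb := (@emb _ _ F).
Implicit Types (s t : gal_of {:E}) (a b : L).

Definition emb_row s : 'rV[E]_(\dim {:L}) := \row_m emb s (vbasis {:L})`_m.

Lemma emb_rowP s t : reflect (emb s =1 emb t) (emb_row s == emb_row t).
Proof.
apply: (iffP eqP) => [/rowP est | est]; last by apply/rowP=> m; rewrite !mxE est.
by apply: linear_basis_ext => m; have := est m; rewrite !mxE.
Qed.

(** Automorphisms of [E] up to agreement on [F], made a finite type through their values on a basis
    of [F]. *)
Definition embedding : predArgType := seq_sub (codom emb_row).
HB.instance Definition _ := Finite.on embedding.

Definition embedding_of s : embedding := SeqSub (codom_f emb_row s).
Definition extension (x : embedding) : gal_of {:E} := iinv (valP x).

Lemma extensionK : cancel extension embedding_of.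
Proof. by move=> x; apply: val_inj; rewrite /= f_iinv. Qed.

Lemma embedding_ofP s t : reflect (emb s =1 emb t) (embedding_of s == embedding_of t).
Proof. exact: emb_rowP. Qed.

Lemma emb_extension s : emb (extension (embedding_of s)) =1 emb s.
Proof. by apply/embedding_ofP; rewrite extensionK. Qed.

(** Right multiplication by [s] means applying [s] after the embedding; [extension x] is an
    arbitrary lift, of which only the restriction to [F] matters. *)
Definition embedding_act (x : embedding) s := embedding_of (extension x * s)%g.

Lemma emb_act x s a : emb (extension (embedding_act x s)) a = s (emb (extension x) a).
Proof. by rewrite emb_extension emb_gal. Qed.

Lemma embedding_act1 : embedding_act^~ 1%g =1 id.
Proof. by move=> x; rewrite /embedding_act mulg1 extensionK. Qed.

Lemma embedding_actM x : act_morph embedding_act x.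
Proof.
move=> s t; apply/eqP/embedding_ofP => a.
by rewrite mulgA !emb_gal -emb_act.
Qed.

Canonical embedding_action := TotalAction embedding_act1 embedding_actM.

Lemma embedding_trans : [transitive [set: gal_of {:E}], on setT | embedding_action].
Proof.
apply/imsetP; exists (embedding_of 1%g); rewrite ?inE //.
apply/esym/setP=> x; rewrite inE; apply/orbitP; exists (extension x) => //.
by apply/eqP; rewrite -[x in _ == x]extensionK; apply/embedding_ofP=> a;
   rewrite !emb_gal emb_extension /emb gal_id.
Qed.

Lemma embedding_stab : 'C_([set: gal_of {:E}])[embedding_of 1%g | embedding_action]%g
  = 'Gal({:E} / F)%g.
Proof.
apply/setP=> s; rewrite inE in_setT /= gal_kHom ?subvf //.
apply/astab1P/kAHomP => [sx a Fa | sF].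
  have := emb_act (embedding_of 1%g) s (vsproj F a).
  rewrite -[embedding_act _ s]/(embedding_action (embedding_of 1%g) s) sx.
  by rewrite !emb_extension /emb gal_id vsprojK.
apply/eqP/embedding_ofP=> a; rewrite emb_gal emb_extension /emb gal_id.
by rewrite sF // subvsP.
Qed.

Lemma gal_setT : 'Gal({:E} / 1)%g = [set: gal_of {:E}].
Proof. by apply/setP=> s; rewrite gal_kHom ?sub1v // k1AHom inE. Qed.

Lemma card_embedding : #|embedding| = #|'Gal({:E} / 1) : 'Gal({:E} / F)|%g.
Proof.
rewrite gal_setT -embedding_stab -card_orbit.
by rewrite (atransP embedding_trans) ?inE // cardsT.
Qed.

End Embeddings.

(** * The regular group attached to a Hopf Galois structure *)

Section RegularSubgroup.
Local Open Scope ring_scope.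
Variables (k : fieldType) (E : splittingFieldType k) (F : {subfield E}).
Variables (H : falgType k) (hopfH : hopfAlgebra H).
Variable rho : moduleAlgebra hopfH (subvs_of F).
Hypothesis rho_bij : bijective (hopf_galois_map rho).

Local Notation L := (subvs_of F).
Local Notation emb := (@emb _ _ F).
Local Notation X := (embedding F).
Local Notation n := (\dim {:H}).
Local Notation h_ j := ((vbasis {:H})`_j).
Local Notation b_ j := ((vbasis {:L})`_j).
Implicit Types (s t : gal_of {:E}) (c : 'rV[E]_n) (a b : L) (x y z : X).

(** Testing on a basis of [L] keeps the relation boolean. *)
Definition carries c x y :=
  [forall m : 'I_(\dim {:L}),
     Phi rho (extension x) c (b_ m) == emb (extension y) (b_ m)].

Lemma carriesP c x y :
  reflect (Phi rho (extension x) c =1 emb (extension y)) (carries c x y).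
Proof.
apply: (iffP forallP) => [xy | xy m]; last by rewrite xy.
by apply: linear_basis_ext => m; apply/eqP/xy.
Qed.

Definition hopf_one : 'rV[E]_n := \row_j (coord (vbasis {:H}) j 1 *: 1).

Definition hopf_mul (c d : 'rV[E]_n) : 'rV[E]_n :=
  \row_j \sum_(i < n) \sum_(l < n) coord (vbasis {:H}) j (h_ i * h_ l) *: (c 0 i * d 0 l).

Lemma emb_actE s h a :
  emb s (act rho h a) = \sum_(j < n) coord (vbasis {:H}) j h *: emb s (act rho (h_ j) a).
Proof.
rewrite {1}(coord_vbasis (memvf h)) linear_sum sum_lfunE linear_sum.
by apply: eq_bigr => j _; rewrite linearZ scale_lfunE linearZ.
Qed.

Lemma Phi_hopf_one s a : Phi rho s hopf_one a = emb s a.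
Proof.
rewrite -[in RHS](Defs.act1 rho a) emb_actE; apply: eq_bigr => j _.
by rewrite mxE -scalerAl mul1r.
Qed.

(** By [actM] the factor [d] acts on [a] first, and [c] then turns [emb s] into [emb t]. Thus if [c]
    carries [x] to [y] and [d] carries [y] to [z], the product carries [x] to [z]. *)
Lemma Phi_hopf_mul s t (c d : 'rV[E]_n) a : Phi rho s c =1 emb t ->
  Phi rho s (hopf_mul c d) a = Phi rho t d a.
Proof.
move=> ct.
transitivity (\sum_(l < n) \sum_(i < n) c 0 i * d 0 l * emb s (act rho (h_ i * h_ l) a)).
  transitivity (\sum_(j < n) \sum_(i < n) \sum_(l < n)
     coord (vbasis {:H}) j (h_ i * h_ l) *: (c 0 i * d 0 l * emb s (act rho (h_ j) a))).
    apply: eq_bigr => j _; rewrite mxE mulr_suml; apply: eq_bigr => i _.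
    by rewrite mulr_suml; apply: eq_bigr => l _; rewrite -scalerAl.
  rewrite exchange_big [RHS]exchange_big /=; apply: eq_bigr => i _.
  rewrite exchange_big; apply: eq_bigr => l _.
  rewrite emb_actE mulr_sumr; apply: eq_bigr => j _.
  by rewrite scalerAr.
apply: eq_bigr => l _; rewrite -ct mulr_sumr; apply: eq_bigr => i _.
by rewrite Defs.actM mulrCA mulrA.
Qed.

(** The semilinear Galois action on E (x) H: [t] moves only the coefficients, since the basis of [H]
    is defined over [k]. *)
Lemma Phi_gal s t c a : Phi rho (s * t)%g (map_mx t c) a = t (Phi rho s c a).
Proof.
rewrite /Phi rmorph_sum; apply: eq_bigr => j _.
by rewrite mxE rmorphM emb_gal.
Qed.

Lemma eq_Phi s t c : emb s =1 emb t -> Phi rho s c =1 Phi rho t c.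
Proof. by move=> st a; apply: eq_bigr => j _; rewrite st. Qed.

Theorem hopf_galois_regular :
  exists N : {group {perm X}},
    [/\ (actperm (embedding_action F) @* [set: gal_of {:E}] \subset 'N(N))%g,
        [transitive N, on setT | 'P]%g & #|N| = #|X|].
Proof.
have ex x y : exists c, carries c x y.
  have [c cE] := Phi_surj rho_bij (extension x) (emb (extension y)).
  by exists c; apply/carriesP.
pose quot x y := xchoose (ex x y).
apply: (@regular_group_of_rel _ _ carries quot hopf_one hopf_mul
          (actperm (embedding_action F) @* [set: gal_of {:E}])%G (embedding_of F 1%g)).
- by move=> x y; apply: (xchooseP (ex x y)).
- move=> c x y z /carriesP xy /carriesP xz.
  apply/eqP; rewrite -(extensionK y) -(extensionK z); apply/embedding_ofP=> a.
  by rewrite -xy xz.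
- move=> c x y /carriesP xy x'; have [t xt] := grouplike_emb rho_bij (extension x') xy.
  by exists (embedding_of F t); apply/carriesP=> a; rewrite emb_extension.
- move=> c c' x z /carriesP xz /carriesP xz'.
  by apply: (Phi_inj rho_bij (s := extension x)) => a; rewrite xz.
- by move=> x; apply/carriesP=> a; rewrite Phi_hopf_one.
- move=> c d x y z /carriesP xy /carriesP yz; apply/carriesP=> a.
  by rewrite (Phi_hopf_mul _ _ xy) yz.
(* Normalization: if [c] carries [x] to [y], then [map_mx s c] carries the translate of [x] by [s]
   to that of [y]. *)
move=> _ c /morphimP[s _ _ ->]; exists (map_mx s c) => x y /carriesP xy.
apply/carriesP=> a; rewrite !actpermE /= emb_act -xy -Phi_gal.
by apply: eq_Phi => b; rewrite emb_extension.
Qed.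

End RegularSubgroup.

(** * Degrees and faithfulness when the Galois group is A_5 *)

Theorem proposition4p9 (k : fieldType) (Kt : splittingFieldType k)
    (K F : {subfield Kt}) :
  separable 1 K -> \dim K = 6%N ->
  galois_closure 1%AS K {:Kt}%AS ->
  'Gal({:Kt} / 1) \isog 'Alt_('I_5) ->
  (K <= F)%VS -> (F : {vspace Kt}) <> fullv ->
  ~ hopf_galois (subvs_of F).
Proof.
move=> _ dimK [_ galKt _] isoA5 sKF Fproper [H [hopfH [rho [_ rho_bij]]]].
have oA5 : #|('Alt_('I_5))%g| = 60%N.
  by apply: double_inj; rewrite -mul2n card_Alt card_ord.
have oG : #|'Gal({:Kt} / 1)%g| = 60%N by rewrite (card_isog isoA5).
have simG : simple 'Gal({:Kt} / 1)%g by rewrite (isog_simple isoA5) simple_Alt5 ?card_ord.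
have dimKt : \dim {:Kt} = 60%N by rewrite -oG -galois_dim // dimv1 divn1.
have d60 : (\dim F %| 60)%N by rewrite -dimKt field_dimS ?subvf.
have oX : #|embedding F| = \dim F.
  rewrite card_embedding -divgS ?galS ?sub1v // oG.
  rewrite -galois_dim ?(galoisS _ galKt) ?sub1v ?subvf // dimKt.
  have [m dm] := dvdnP d60; rewrite dm mulnK ?adim_gt0 // mulKn //.
  by case: m dm.
(* [\dim F] is a multiple of 6 and a proper divisor of 60. *)
have dimF : (\dim F \in [:: 6; 12; 30])%N.
  have d6 : (6 %| \dim F)%N by rewrite -dimK field_dimS.
  have n60 : \dim F != 60%N.
    by apply/eqP=> F60; apply: Fproper; apply/eqP; rewrite eqEdim subvf dimKt F60.
  have := dvdn_leq (isT : 0 < 60)%N d60; move: d6 d60 n60.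
  by case/dvdnP=> d ->; move: d; do 11?case => //.
have [N [nN trN oN]] := hopf_galois_regular rho_bij.
set f := actperm_morphism (embedding_action F).
have {}simG : simple [set: gal_of {:Kt}]%g by rewrite -gal_setT.
have {}oG : #|[set: gal_of {:Kt}]| = 60%N by rewrite -gal_setT.
have isoQ : ([set: gal_of {:Kt}] \isog f @* [set: gal_of {:Kt}])%g.
  apply: (@sub_isog _ _ _ f) => //.
  (* By simplicity the action on the embeddings is faithful or trivial; if trivial, transitivity
     would leave a single embedding, against [dimF]. *)
  have [_ simG'] := simpleP _ simG; case: (simG' _ (ker_normal f)) => [-> // | kerT].
  have: #|embedding F| = 1%N.
    rewrite card_embedding -embedding_stab gal_setT (_ : 'C__[_ | _]%g = setT).
      exact: indexgg.
    apply/setIidPl/subsetP=> s sT; apply/astab1P.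
    have: (s \in 'ker f)%g by rewrite kerT.
    by move/mker => /permP/(_ (embedding_of F 1%g)); rewrite perm1 actpermE.
  by move: dimF; rewrite oX !inE => /or3P[] /eqP->.
apply: (@no_regular_normalized _ N (f @* [set: gal_of {:Kt}])%G) => //.
- by rewrite -(isog_simple isoQ).
- by rewrite -(card_isog isoQ).
- by rewrite oX.
Qed.
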